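(* Let $a,b\ge1$ and $P=[a]\times[b]$ with the product order. Let $x_1,\dots,x_{ab}$ be any enumeration of the elements $(k,\ell)$ of $P$ in weakly increasing order of $\ell-k$, and define promotion $\partial_J:J(P)\to J(P)$ by $\partial_J=\sigma_{x_{ab}}\circ\sigma_{x_{ab-1}}\circ\cdots\circ\sigma_{x_1}$. Then the cardinality statistic $I\mapsto\#I$ is $c$-mesic under $\partial_J$ with $c=ab/2$: for every $\partial_J$-orbit $\mathcal{O}\subseteq J(P)$, $\frac{1}{\#\mathcal{O}}\sum_{I\in\mathcal{O}}\#I=\frac{ab}{2}$.
   Context: $[n]$ denotes the chain $1<2<\dots<n$; in $[a]\times[b]$, $(k,\ell)\le(k',\ell')$ iff $k\le k'$ and $\ell\le\ell'$. $J(P)$ is the set of order ideals (down-closed subsets) of $P$. For $x\in P$, the toggle $\sigma_x:J(P)\to J(P)$ sends $I$ to $I\triangle\{x\}$ if this is an order ideal, and to $I$ otherwise. Toggles at elements with the same value of $\ell-k$ commute, so $\partial_J$ does not depend on the chosen enumeration; $\partial_J$ is invertible of finite order. $c$-mesic means the average over every orbit equals $c$. *)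

(* Defs.v *)
From HB Require Import structures.
From mathcomp Require Import all_boot all_order all_algebra.

Set Implicit Arguments.
Unset Strict Implicit.
Unset Printing Implicit Defensive.

Import Order.TTheory GRing.Theory Num.Theory.
Local Open Scope ring_scope.

Section OrderIdeals.
Variables (d : Order.disp_t) (P : finPOrderType d).

Definition order_ideal (I : {set P}) : bool :=
  [forall x in I, forall y, (y <= x)%O ==> (y \in I)].

Definition ideals : finType := {I : {set P} | order_ideal I}.

Definition flip (x : P) (I : {set P}) : {set P} :=
  (I :\: [set x]) :|: ([set x] :\: I).

(* [insubd I A] is [A] when [A] is an order ideal and [I] otherwise. *)
Definition toggle (x : P) (I : ideals) : ideals := insubd I (flip x (val I)).

(* The head of [xs] is toggled first. *)
Definition toggles (xs : seq P) (I : ideals) : ideals :=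
  foldl (fun J x => toggle x J) I xs.

Lemma flipK (x : P) : involutive (flip x).
Proof.
by move=> A; apply/setP => y; rewrite !inE; case: (y == x); case: (y \in A).
Qed.

Lemma toggleK (x : P) : involutive (toggle x).
Proof.
move=> I; apply: val_inj; rewrite /toggle !val_insubd.
case idI: (order_ideal (flip x (val I))); first by rewrite flipK (valP I).
by rewrite idI.
Qed.

Lemma toggles_inj (xs : seq P) : injective (toggles xs).
Proof.
elim: xs => [|x xs IHxs] I J; first by [].
by move/IHxs; apply: (inv_inj (toggleK x)).
Qed.

End OrderIdeals.

(* Forward orbits under [fconnect f] are genuine orbits when [f] is injective;
   [toggles_inj] covers the use made of it here. *)
Definition is_orbit (T : finType) (f : T -> T) (O : {set T}) : Prop :=
  exists x, O = [set y | fconnect f x y].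

Definition mesic (T : finType) (f : T -> T) (stat : T -> rat) (c : rat) : Prop :=
  forall O : {set T}, is_orbit f O -> #|O|%:R^-1 * (\sum_(I in O) stat I) = c.

(* The chain [n] is encoded as 'I_n, so (k, l) is represented by (k-1, l-1);
   this leaves l - k unchanged. *)
Definition rect (a b : nat) : finPOrderType _ := ('I_a *p 'I_b)%type.

Definition file (a b : nat) (x : rect a b) : int := x.2%:Z - x.1%:Z.

Definition file_enumeration (a b : nat) (xs : seq (rect a b)) : Prop :=
  [/\ uniq xs, forall x, x \in xs
    & sorted (fun x y => file x <= file y) xs].

Definition promotion (a b : nat) (xs : seq (rect a b)) :
  ideals (rect a b) -> ideals (rect a b) := toggles xs.

(* Main.v *)
Require Import Defs.
From HB Require Import structures.
From mathcomp Require Import all_boot all_order all_algebra.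
From mathcomp Require Import zify ring.

Set Implicit Arguments.
Unset Strict Implicit.
Unset Printing Implicit Defensive.

Import Order.TTheory GRing.Theory Num.Theory.
Local Open Scope ring_scope.

(** Counting 1 for a true statement, the membership of [x] in [I] before and
    after the toggle at [x] adds up to "everything below [x] is in [I]" plus
    "something above [x] is in [I]".  In the rectangle only the four neighbours
    of [x] matter, and the first statement at [x + (1, 1)] involves the same two
    points as the second one at [x].  Since [(p && q) + (p || q) = p + q], the
    sum of these relations with a weight [w] of the file that vanishes on the
    files [- a] and [b] is
    [\sum_(x in I') (w (file x) - w (file x + 1)) +
     \sum_(x in I) (w (file x) - w (file x - 1)) = w 0],
    where [I'] is the promotion of [I].  Over an orbit [I'] may be replaced by
    [I], so the sum over [I] of minus the second difference of [w] is
    [w 0]-mesic.  The weight [w i = (i + a) (b - i) / 2] has second difference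
    [- 1]. *)

Section Mesic.
Variables (T : finType) (f : T -> T).
Hypothesis f_inj : injective f.

Lemma sum_orbit_comp (V : nmodType) (F : T -> V) (O : {set T}) :
  is_orbit f O -> \sum_(x in O) F (f x) = \sum_(x in O) F x.
Proof.
case=> x ->; rewrite [RHS](reindex_inj f_inj) /=.
by apply: eq_bigl => y; rewrite !inE -same_fconnect1_r.
Qed.

Lemma orbit_card_neq0 (O : {set T}) : is_orbit f O -> #|O| != 0%N.
Proof.
by case=> x ->; rewrite -lt0n; apply/card_gt0P; exists x; rewrite inE.
Qed.

Lemma mesic_of_shifted_sum (s t : T -> rat) (c : rat) :
  (forall x, s (f x) + t x = c) -> mesic f (fun x => s x + t x) c.
Proof.
move=> stE O orbO; rewrite big_split /= -(sum_orbit_comp s) // -big_split /=.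
under eq_bigr do rewrite stE.
by rewrite sumr_const -[c *+ _]mulr_natl mulKf // pnatr_eq0 orbit_card_neq0.
Qed.

End Mesic.

Section Toggles.
Variables (d : Order.disp_t) (P : finPOrderType d).
Implicit Types (I : ideals P) (A : {set P}) (x y : P) (s xs : seq P).

Lemma order_idealP A :
  reflect (forall x y, x \in A -> (y <= x)%O -> y \in A) (order_ideal A).
Proof.
apply: (iffP forall_inP) => [idA x y xA yx | idA x xA].
  by move/forallP: (idA x xA) => /(_ y) /implyP; apply.
by apply/forallP => y; apply/implyP; apply: idA xA.
Qed.

Lemma ideals_le I x y : x \in val I -> (y <= x)%O -> y \in val I.
Proof. by move: x y; apply/order_idealP; apply: valP. Qed.

Lemma flipE x A : flip x A = if x \in A then A :\ x else x |: A.
Proof.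
by apply/setP => y; case: ifP => xA; rewrite !inE; have [->|] := eqVneq y x;
  rewrite ?xA ?andbF ?orbF.
Qed.

Lemma order_ideal_setD1 I x :
  order_ideal (val I :\ x) = ~~ [exists y in val I, (x < y)%O].
Proof.
apply/order_idealP/exists_inPn => [idl y yI | noup y z].
  apply/negP => xy; have := idl y x.
  by rewrite !inE eqxx yI (gt_eqF xy) (ltW xy) => /(_ isT isT).
rewrite !inE => /andP[yx yI] zy; rewrite (ideals_le yI zy) andbT.
apply: contraNneq (noup y yI) => zx; rewrite -zx in yx *.
by rewrite lt_neqAle eq_sym yx.
Qed.

Lemma order_ideal_setU1 I x :
  order_ideal (x |: val I) = [forall y, (y < x)%O ==> (y \in val I)].
Proof.
apply/order_idealP/forallP => [idl y | low y z].
  apply/implyP => yx; have := idl x y.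
  by rewrite !inE eqxx (lt_eqF yx) (ltW yx); apply.
rewrite !inE => /predU1P[->|yI] zy; last by rewrite (ideals_le yI zy) orbT.
by have := low z; rewrite lt_neqAle zy andbT; case: eqP.
Qed.

Lemma add_mem_toggle x I :
  ((x \in val (toggle x I)) + (x \in val I) =
   [forall y, (y < x)%O ==> (y \in val I)] + [exists y in val I, (x < y)%O])%N.
Proof.
rewrite -order_ideal_setU1 -[[exists y in _, _]]negbK -order_ideal_setD1.
rewrite /toggle val_insubd flipE; case: (boolP (x \in val I)) => xI.
  have -> : x |: val I = val I by apply/setUidPr; rewrite sub1set.
  by rewrite (valP I); case: ifP; rewrite ?inE ?eqxx ?xI.
have -> : val I :\ x = val I by apply/setDidPl; rewrite disjoint_sym disjoints1.
by rewrite (valP I); case: ifP; rewrite ?inE ?eqxx ?(negPf xI).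
Qed.

Lemma mem_toggle_neq x y I : y != x -> (y \in val (toggle x I)) = (y \in val I).
Proof.
move=> yx; rewrite /toggle val_insubd; case: ifP => // _.
by rewrite flipE; case: ifP; rewrite !inE (negPf yx).
Qed.

Lemma mem_toggles_notin xs y I :
  y \notin xs -> (y \in val (toggles xs I)) = (y \in val I).
Proof.
elim: xs I => [|x xs IHxs] I //=; rewrite inE negb_or => /andP[yx yxs].
by rewrite IHxs // mem_toggle_neq.
Qed.

Lemma toggles_cat s1 s2 I : toggles (s1 ++ s2) I = toggles s2 (toggles s1 I).
Proof. exact: foldl_cat. Qed.

Lemma mem_toggles_prefix s1 s2 y I : uniq (s1 ++ s2) ->
  (y \in val (toggles s1 I)) =
  (y \in val (if y \in s1 then toggles (s1 ++ s2) I else I)).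
Proof.
rewrite cat_uniq => /and3P[_ /hasPn disj _].
case: ifPn => ys1; last exact: mem_toggles_notin.
by rewrite toggles_cat [RHS]mem_toggles_notin //; apply: contraTN ys1 => /disj.
Qed.

End Toggles.

Lemma rect_leE (a b : nat) (x y : rect a b) :
  (x <= y)%O = (x.1 <= y.1)%N && (x.2 <= y.2)%N.
Proof. by []. Qed.

Lemma rect_eqE (a b : nat) (x y : rect a b) :
  (x == y) = (x.1 == y.1 :> nat) && (x.2 == y.2 :> nat).
Proof. by []. Qed.

Lemma rect_ltE (a b : nat) (x y : rect a b) :
  (x < y)%O =
  (x.1 < y.1)%N && (x.2 <= y.2)%N || (x.1 <= y.1)%N && (x.2 < y.2)%N.
Proof. by rewrite lt_neqAle rect_leE rect_eqE; lia. Qed.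

Section Extension.
Variables a b : nat.
Implicit Types (I : ideals (rect a b)) (A B : {set rect a b}) (x y : rect a b).

(* Coordinates start at 1 here, and the axes belong to the extension: a
   neighbour outside the rectangle then counts as present below and as absent
   above. *)
Definition extension A (k l : nat) : bool :=
  [|| k == 0, l == 0 |
      [exists x in A, (x.1.+1 == k :> nat) && (x.2.+1 == l :> nat)]]%N.

Lemma mem_extension A x : extension A x.1.+1 x.2.+1 = (x \in A).
Proof.
apply/exists_inP/idP => [[y yA] | xA]; last by exists x; rewrite ?eqxx.
by rewrite !eqSS -rect_eqE => /eqP <-.
Qed.

Lemma extension_axis A k : extension A k 0.
Proof. by rewrite /extension orbT. Qed.

Lemma extension_out A k l :
  (a <= k)%N || (b <= l)%N -> extension A k.+1 l.+1 = false.
Proof.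
apply: contraTF => /exists_inP[x _ /andP[/eqP[<-] /eqP[<-]]].
by rewrite negb_or -!ltnNge !ltn_ord.
Qed.

Lemma eq_extension_file A B (k l : nat) :
    (forall x, file x = l%:Z - k%:Z -> (x \in A) = (x \in B)) ->
  extension A k l = extension B k l.
Proof.
move=> eqAB; congr [|| _, _ | _]; apply: eq_existsb => x.
apply: andb_id2r => /andP[/eqP xk /eqP xl].
by apply: eqAB; rewrite /file -xk -xl; lia.
Qed.

Lemma extension_ideal I (k l : nat) :
  extension (val I) k.+1 l.+1 =
  [exists x in val I, (k <= x.1)%N && (l <= x.2)%N].
Proof.
apply/exists_inP/exists_inP => -[x xI]; first by exists x => //; lia.
move=> /andP[kx lx]; pose y : rect a b :=
  (Ordinal (leq_ltn_trans kx (ltn_ord x.1)),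
   Ordinal (leq_ltn_trans lx (ltn_ord x.2))).
by exists y; rewrite ?eqxx // (ideals_le xI) // rect_leE kx.
Qed.

Lemma exists_above_extension I x :
  [exists y in val I, (x < y)%O] =
  extension (val I) x.1.+2 x.2.+1 || extension (val I) x.1.+1 x.2.+2.
Proof.
rewrite !extension_ideal; apply/exists_inP/orP => [[y yI] | ].
  by rewrite rect_ltE => /orP[] xy; [left|right]; apply/exists_inP; exists y.
by case=> /exists_inP[y yI xy]; exists y; rewrite // rect_ltE xy ?orbT.
Qed.

Lemma forall_below_extension I x :
  [forall y, (y < x)%O ==> (y \in val I)] =
  extension (val I) x.1 x.2.+1 && extension (val I) x.1.+1 x.2.
Proof.
apply/forallP/andP => [low | [low1 low2] y].
  case: x low => -[k ka] [l lb] low; split.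
    case: k ka low => // k ka low.
    pose y : rect a b := (Ordinal (ltnW ka), Ordinal lb).
    rewrite (mem_extension _ y); apply: (implyP (low y)).
    by rewrite rect_ltE /= ltnSn leqnn.
  case: l lb low => // l lb low.
  pose y : rect a b := (Ordinal ka, Ordinal (ltnW lb)).
  rewrite (mem_extension _ y); apply: (implyP (low y)).
  by rewrite rect_ltE /= ltnSn leqnn orbT.
have ideal_at k l :
    extension (val I) k.+1 l.+1 -> (y.1 <= k)%N -> (y.2 <= l)%N -> y \in val I.
  rewrite extension_ideal => /exists_inP[z zI /andP[kz lz]] yk yl.
  by apply: ideals_le zI _; rewrite rect_leE; lia.
apply/implyP; rewrite rect_ltE => /orP[] /andP[lt1 lt2].
  by move: low1; rewrite -(ltn_predK lt1) => /ideal_at; apply; lia.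
by move: low2; rewrite -(ltn_predK lt2) => /ideal_at; apply; lia.
Qed.

Lemma add_extension_promotion (xs : seq (rect a b)) I (k l : nat)
    (m := extension (val I)) (m' := extension (val (promotion xs I))) :
    file_enumeration xs -> (k < a)%N -> (l < b)%N ->
  (m' k.+1 l.+1 + m k.+1 l.+1 =
   (m k l.+1 && m' k.+1 l) + (m' k.+2 l.+1 || m k.+1 l.+2))%N.
Proof.
case=> uxs in_xs sxs ka lb; pose x : rect a b := (Ordinal ka, Ordinal lb).
have /splitPr xsE := in_xs x; rewrite {}/m {}/m'.
case: xsE uxs in_xs sxs => s1 s2 uxs in_xs.
have file_trans : transitive (fun y z : rect a b => file y <= file z).
  by move=> y z t; apply: le_trans.
rewrite sorted_pairwise // pairwise_cat.
move=> /and3P[/allrelP s1_le _ /andP[/allP s2_ge _]].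
set I' := promotion _ I; pose J := toggles s1 I.
have before y : file y < file x -> (y \in val J) = (y \in val I').
  move=> yx; rewrite (mem_toggles_prefix _ _ uxs); case: ifPn => // ys1.
  have := in_xs y; rewrite mem_cat (negPf ys1) inE => /predU1P[yxE | /s2_ge].
    by rewrite yxE ltxx in yx.
  by rewrite leNgt yx.
have after y : file x < file y -> (y \in val J) = (y \in val I).
  move=> xy; apply: mem_toggles_notin; apply: contraTN xy => ys1.
  by rewrite -leNgt s1_le ?mem_head.
have [xs1 xs2] : x \notin s1 /\ x \notin s2.
  by move: uxs; rewrite cat_uniq /= negb_or => /and4P[_ /andP[-> _] -> _].
rewrite -[k]/(x.1 : nat) -[l]/(x.2 : nat) !mem_extension.
have -> : (x \in val I') = (x \in val (toggle x J)).
  by rewrite -(mem_toggles_notin (toggle x J) xs2) /I' /promotion toggles_cat.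
rewrite -(mem_toggles_notin I xs1) add_mem_toggle.
rewrite forall_below_extension exists_above_extension.
congr (nat_of_bool (_ && _) + nat_of_bool (_ || _))%N;
  apply: eq_extension_file => y yE;
  [apply: after | apply: before | apply: before | apply: after];
  by rewrite yE /file; lia.
Qed.

End Extension.

Lemma sum_ord_shift (V : nmodType) (n : nat) (F : nat -> V) :
  F n = 0 -> \sum_(k < n) F k = F 0%N + \sum_(k < n) F k.+1.
Proof.
move=> Fn; transitivity (\sum_(k < n.+1) F k); last exact: big_ord_recl.
by rewrite big_ord_recr /= Fn addr0.
Qed.

Lemma sum_grid_shift (V : nmodType) (a b : nat) (F : nat -> nat -> V) :
    (forall l, F a l = 0) -> (forall k, F k b = 0) ->
  \sum_(k < a) \sum_(l < b) F k l =
  F 0%N 0%N + \sum_(l < b) F 0%N l.+1 + \sum_(k < a) F k.+1 0%N +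
  \sum_(k < a) \sum_(l < b) F k.+1 l.+1.
Proof.
move=> Fa Fb; rewrite (@sum_ord_shift _ a (fun k => \sum_(l < b) F k l)).
  rewrite sum_ord_shift // -!addrA -big_split /=; congr (_ + (_ + _)).
  by apply: eq_bigr => k _; rewrite (sum_ord_shift (Fb k.+1)).
by rewrite big1.
Qed.

Section WeightedSum.
Variables (a b : nat) (V : zmodType) (w : int -> V).
Implicit Types (A : {set rect a b}) (I : ideals (rect a b)).
Implicit Types p : nat -> nat -> bool.

Definition grid_weight (v : int -> V) p : V :=
  \sum_(k < a) \sum_(l < b) v (l%:Z - k%:Z) *+ p k l.

Lemma eq_grid_weightD (p q p' q' : nat -> nat -> bool) :
    (forall k l, (k < a)%N -> (l < b)%N ->
      (p k l + q k l = p' k l + q' k l)%N) ->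
  grid_weight w p + grid_weight w q = grid_weight w p' + grid_weight w q'.
Proof.
move=> pqE; rewrite -!big_split; apply: eq_bigr => k _ /=.
by rewrite -!big_split; apply: eq_bigr => l _ /=; rewrite -!mulrnDr pqE.
Qed.

Lemma grid_weight_shift p :
    w (- a%:Z) = 0 -> w b = 0 ->
    (forall l, p a l.+1 = false) -> (forall k, p k.+1 b = false) ->
  grid_weight w p =
  w 0 *+ p 0 0 + \sum_(l < b) w l.+1 *+ p 0 l.+1 +
  \sum_(k < a) w (- k.+1%:Z) *+ p k.+1 0 +
  grid_weight w (fun k l => p k.+1 l.+1).
Proof.
move=> w_a w_b p_a p_b; rewrite /grid_weight.
rewrite (@sum_grid_shift _ a b (fun k l => w (l%:Z - k%:Z) *+ p k l)).
- congr (_ + _ + _ + _).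
  + by apply: eq_bigr => l _; rewrite subr0.
  + by apply: eq_bigr => k _; rewrite sub0r.
  + by apply: eq_bigr => k _; apply: eq_bigr => l _; congr (w _ *+ _); lia.
- by case=> [|l]; rewrite ?sub0r ?w_a ?mul0rn // p_a.
- by case=> [|k]; rewrite ?subr0 ?w_b ?mul0rn // p_b.
Qed.

Lemma sum_rect_grid_weight (v : int -> V) A :
  \sum_(x in A) v (file x) =
  grid_weight v (fun k l => extension A k.+1 l.+1).
Proof.
rewrite /grid_weight pair_bigA big_mkcond /=; apply: eq_bigr => x _.
by rewrite mem_extension; case: (x \in A).
Qed.

Lemma sum_weight_next_file A :
  \sum_(x in A) w (file x + 1) =
  \sum_(l < b) w l.+1 *+ extension A 1 l.+1 +
  grid_weight w (fun k l => extension A k.+2 l.+1).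
Proof.
rewrite (sum_rect_grid_weight (fun i => w (i + 1))) /grid_weight.
rewrite (@sum_ord_shift _ a (fun k =>
  \sum_(l < b) w (l%:Z - k%:Z + 1) *+ extension A k.+1 l.+1)) /=.
  congr (_ + _); first by apply: eq_bigr => l _; congr (w _ *+ _); lia.
  by apply: eq_bigr => k _; apply: eq_bigr => l _; congr (w _ *+ _); lia.
by apply: big1 => l _; rewrite extension_out ?leqnn.
Qed.

Lemma sum_weight_prev_file A :
  \sum_(x in A) w (file x - 1) =
  \sum_(k < a) w (- k.+1%:Z) *+ extension A k.+1 1 +
  grid_weight w (fun k l => extension A k.+1 l.+2).
Proof.
rewrite (sum_rect_grid_weight (fun i => w (i - 1))) -big_split /=.
apply: eq_bigr => k _; rewrite (@sum_ord_shift _ b (fun l =>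
  w (l%:Z - k%:Z - 1) *+ extension A k.+1 l.+1)) /=.
  congr (_ + _); first by congr (w _ *+ _); lia.
  by apply: eq_bigr => l _; congr (w _ *+ _); lia.
by rewrite extension_out ?leqnn ?orbT.
Qed.

Lemma sum_weight_promotion (xs : seq (rect a b)) I :
    file_enumeration xs -> w (- a%:Z) = 0 -> w b = 0 ->
  \sum_(x in val (promotion xs I)) (w (file x) - w (file x + 1)) +
  \sum_(x in val I) (w (file x) - w (file x - 1)) = w 0.
Proof.
move=> enum_xs w_a w_b.
pose m := extension (val I); pose m' := extension (val (promotion xs I)).
pose below k l := m k l.+1 && m' k.+1 l.
pose above k l := m' k.+2 l.+1 || m k.+1 l.+2.
have toggle_sum :
    \sum_(x in val (promotion xs I)) w (file x) +
    \sum_(x in val I) w (file x) =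
    grid_weight w below + grid_weight w above.
  rewrite !sum_rect_grid_weight; apply: eq_grid_weightD => k l.
  exact: add_extension_promotion.
have below_above :
    grid_weight w (fun k l => below k.+1 l.+1) + grid_weight w above =
    grid_weight w (fun k l => m' k.+2 l.+1) +
    grid_weight w (fun k l => m k.+1 l.+2).
  apply: eq_grid_weightD => k l _ _.
  by rewrite /below /above; case: (m' _ _); case: (m _ _).
have below_shift : grid_weight w below =
    w 0 + \sum_(l < b) w l.+1 *+ m' 1 l.+1 +
    \sum_(k < a) w (- k.+1%:Z) *+ m k.+1 1 +
    grid_weight w (fun k l => below k.+1 l.+1).
  rewrite grid_weight_shift // /below /m /m' => [|l|k].
  - congr (_ + _ + _ + _).
    by apply: eq_bigr => k _; rewrite extension_axis andbT.
  - by rewrite [extension _ a.+1 _]extension_out ?leqnn // andbF.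
  - by rewrite extension_out ?leqnn ?orbT.
rewrite !big_split /= !sumrN addrACA -opprD.
apply/eqP; rewrite subr_eq; apply/eqP.
rewrite toggle_sum below_shift -addrA below_above.
by rewrite sum_weight_next_file sum_weight_prev_file [in RHS]addrACA !addrA.
Qed.

End WeightedSum.

Theorem theorem19 (a b : nat) (ha : (1 <= a)%N) (hb : (1 <= b)%N)
    (xs : seq (rect a b)) (hxs : file_enumeration xs) :
  mesic (promotion xs)
    (fun I : ideals (rect a b) => #|val I|%:R) ((a * b)%:R / 2%:R).
Proof.
pose w (i : int) : rat := (i + a)%:~R * (b%:Z - i)%:~R / 2%:R.
pose forward (I : ideals (rect a b)) :=
  \sum_(x in val I) (w (file x) - w (file x + 1)).
pose backward (I : ideals (rect a b)) :=
  \sum_(x in val I) (w (file x) - w (file x - 1)).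
have cardE (I : ideals (rect a b)) : #|val I|%:R = forward I + backward I.
  rewrite /forward /backward -big_split -sum1_card natr_sum.
  by apply: eq_bigr => x _ /=; rewrite /w; field.
have promotionE (I : ideals (rect a b)) :
    forward (promotion xs I) + backward I = (a * b)%:R / 2%:R.
  rewrite (sum_weight_promotion I hxs) /w ?addNr ?subrr ?mulr0 ?mul0r //.
  by rewrite add0r subr0 -rmorphM.
move=> O /(mesic_of_shifted_sum (@toggles_inj _ _ xs) promotionE) <-.
by under eq_bigr do rewrite cardE.
Qed.
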